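(* Let $G$ be a finite simple graph with a proper edge-coloring, and let $\delta = \delta(G) \ge 1$ be its minimum degree. If $$|V(G)| > \frac{13}{2}\delta - \frac{23}{2} + \frac{41}{8\delta},$$ then $G$ contains a rainbow matching of size $\delta$.
   Context: All graphs are finite and simple. $\delta(G)$ denotes the minimum degree of $G$. A proper edge-coloring assigns a color to each edge so that any two distinct edges sharing an endpoint receive distinct colors (any number of colors may be used). A rainbow matching in an edge-colored graph is a matching (a set of pairwise disjoint edges) in which all edges have distinct colors; its size is its number of edges. *)

(* Defs.v *)
(* A finite simple graph on the vertex type T is a symmetric
   irreflexive relation e : rel T. *)
From mathcomp Require Import all_boot.

Set Implicit Arguments.
Unset Strict Implicit.
Unset Printing Implicit Defensive.

Section Graph.

Variables (T : finType) (e : rel T).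

Definition edges : {set {set T}} :=
  [set [set p.1; p.2] | p : T * T & e p.1 p.2].

Definition degree (x : T) : nat := #|[set y | e x y]|.

(* Every degree is at most #|T|, so the neutral value #|T| is harmless: this is
   the minimum of the degrees when T is nonempty, and 0 when T is empty. *)
Definition min_degree : nat := \big[minn/#|T|]_(x : T) degree x.

(* A coloring is a total function on sets of vertices; only its values on edges
   are ever constrained. *)
Definition proper_edge_coloring (C : eqType) (c : {set T} -> C) : Prop :=
  {in edges &, forall A B : {set T},
    A != B -> ~~ [disjoint A & B] -> c A != c B}.

Definition matching (M : {set {set T}}) : Prop :=
  M \subset edges /\ trivIset M.

Definition rainbow_matching (C : eqType) (c : {set T} -> C)
    (M : {set {set T}}) : Prop :=
  matching M /\ {in M &, injective c}.

End Graph.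

(* Main.v *)
Require Import Defs.
From mathcomp Require Import all_boot all_order all_algebra.
From mathcomp Require Import zify ring lra.
Import Order.TTheory GRing.Theory Num.Theory.

Set Implicit Arguments.
Unset Strict Implicit.
Unset Printing Implicit Defensive.

Local Open Scope nat_scope.

(** Write d for the minimum degree, k = d - 1 and n for the order. The graph is
   handled as a vertex set V with a set E of two-element sets, so that removing
   vertices or edges stays inside one vertex type, and the claim is proved by
   induction on d, then on the number of edges, for all graphs whose degrees
   are at least d.

   Two reductions. A vertex of degree more than 3k can be deleted: a rainbow
   matching of size k of the rest covers 2k vertices and uses k colors, hence
   rules out at most 3k of its edges ([extend_rainbow]). An edge both of whose
   ends have degree more than d can be deleted as well. So every edge has an end
   of degree exactly d and degree sum at most d + 3k.

   In a graph so reduced, run the following greedy algorithm: take a smallest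
   color class, choose in it an edge of least degree sum, then delete its ends
   and its color. Removing two vertices removes at most two edges of any other
   color, so the size of the smallest class drops by at most 2 per step. Reading
   the run backwards from the last step at which an unchosen color disappears,
   this gives h edges B_1, ..., B_h such that, outside the vertices they cover,
   only f_i <= 2(h - i) + 1 edges of the color of B_i survive, while the other
   surviving colors are so few, say m, that the algorithm still finds h + m
   edges ([greedy_decomposition]). If h + m > k we are done.

   Otherwise count degrees in the uncovered set R ([sum_deg_uncovered]). If B_i
   has degree sum 2d + g_i, the degrees in R add up to at most
   m |R| + sum_i (2k + g_i) + 2 sum_i f_i. A large g_i is paid for: by the choice
   of B_i, each of the f_i surviving edges of its color has a vertex in R whose
   degree exceeds d by at least g_i. Choosing distinct such vertices for a of
   the B_i, as many as a greedy choice allows, covers all the g_i up to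
   (2k - 1)(h - a) and forces sum_i f_i <= 2ha - a^2 ([partial_representatives]).
   Maximizing the resulting bound on n over m + h <= k and a <= h gives the
   order in the theorem ([order_bound]): the worst case is h = k with a close
   to (2k + 1) / 4. *)

(** * Double counting and distinct representatives *)

Section Counting.

Variables (T : finType).
Implicit Types (F : {set {set T}}) (A B Z : {set T}).

(** Both sides count the pairs (A, z) with z in A and in Z. *)
Lemma sum_card_setI F Z :
  \sum_(A in F) #|A :&: Z| = \sum_(z in Z) #|[set A in F | z \in A]|.
Proof.
transitivity (\sum_(A in F) \sum_(z in Z) (z \in A : nat)).
  apply: eq_bigr => A _; rewrite -sum1_card -big_mkcondr /=.
  by apply: eq_bigl => z; rewrite inE andbC.
rewrite exchange_big; apply: eq_bigr => z _ /=.
rewrite -sum1_card -big_mkcondr /=.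
by apply: eq_bigl => A; rewrite inE.
Qed.

Lemma other_endpoint A x :
  #|A| = 2 -> x \in A -> exists2 y, y \in A & A :\ x = [set y].
Proof.
move=> A2 xA; have /cards1P[y Ay] : #|A :\ x| == 1.
  by move: A2; rewrite (cardsD1 x) xA add1n => -[->].
by exists y; rewrite //; have := set11 y; rewrite -Ay inE => /andP[].
Qed.

(** Disjoint sets meet Z in distinct points. *)
Lemma card_disjoint_hitting F Z :
    {in F &, forall A B, A != B -> [disjoint A & B]} ->
    {in F, forall A, ~~ [disjoint A & Z]} ->
  #|F| <= #|Z|.
Proof.
move=> disjF hitF; rewrite -[#|F|]sum1_card.
apply: (@leq_trans (\sum_(A in F) #|A :&: Z|)).
  by apply: leq_sum => A AF; rewrite card_gt0 setI_eq0 hitF.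
rewrite sum_card_setI -[#|Z|]sum1_card; apply: leq_sum => z _.
apply/card_le1_eqP => A B; rewrite !inE => /andP[AF zA] /andP[BF zB].
apply/eqP/contraT => neqAB.
by have := disjointFl (disjF _ _ BF AF neqAB) zA; rewrite zB.
Qed.

Lemma card_has_le (X : finType) (I : Type) (s : seq I) (P : pred X)
    (Q : I -> pred X) :
  #|[set x | P x && has (Q^~ x) s]| <= \sum_(i <- s) #|[set x | P x && Q i x]|.
Proof.
elim: s => [|i s IHs].
  by rewrite big_nil leqn0 cards_eq0; apply/eqP/setP => x; rewrite !inE andbF.
rewrite big_cons; apply: leq_trans (leq_add (leqnn _) IHs).
apply: leq_trans (leq_card_setU _ _); apply/subset_leq_card/subsetP => x.
by rewrite !inE /= andb_orr.
Qed.

(** Go through s from its end, giving i a representative in V i outside the set Z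
   of those already given. If f i > #|Z| then V i is too large to be used up;
   otherwise i is skipped, which costs b, but f i is at most #|Z|. In the
   potential 2 * size s * #|Z| - #|Z| ^ 2 the first case gains
   2 * size s2 + 1, the given bound on f i, and the second case gains 2 * #|Z|. *)
Lemma partial_representatives (I : eqType) (s : seq I) (f g : I -> nat)
    (V : I -> {set T}) (ex : T -> nat) (b : nat) :
    (forall s1 i s2, s = s1 ++ i :: s2 -> f i <= (size s2).*2.+1) ->
    {in s, forall i, f i <= #|V i|} ->
    {in s, forall i v, v \in V i -> g i <= ex v} ->
    {in s, forall i, g i <= b} ->
  exists Z : {set T},
    [/\ #|Z| <= size s,
        {in Z, forall v, exists2 i, i \in s & v \in V i},
        \sum_(i <- s) g i <= \sum_(v in Z) ex v + b * (size s - #|Z|)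
      & \sum_(i <- s) f i + #|Z| ^ 2 <= 2 * size s * #|Z| ].
Proof.
elim: s => [|i s IHs] fle fV gV gb.
  by exists set0; rewrite !big_nil cards0; split=> // v; rewrite inE.
have [|j js|j js|j js|Z [Zs ZV gZ fZ]] := IHs.
- by move=> s1 j s2 s_eq; apply: (fle (i :: s1)); rewrite s_eq.
- by apply: fV; rewrite inE js orbT.
- by apply: gV; rewrite inE js orbT.
- by apply: gb; rewrite inE js orbT.
have is_i : i \in i :: s by rewrite mem_head.
have fi := fle [::] i s erefl.
rewrite !big_cons /=.
have [fiZ|Zfi] := leqP (f i) #|Z|.
  exists Z; split.
  - by rewrite ltnW.
  - by move=> v /ZV[j js vj]; exists j; rewrite // inE js orbT.
  - have := gb _ is_i; rewrite subSn // mulnS; lia.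
  - nia.
have /subsetPn[v vV vZ] : ~~ (V i \subset Z).
  apply/negP => /subset_leq_card VZ.
  by have := leq_trans Zfi (leq_trans (fV _ is_i) VZ); rewrite ltnn.
exists (v |: Z); rewrite cardsU1 vZ /= add1n; split.
- by rewrite ltnS.
- move=> u; rewrite !inE => /orP[/eqP ->|/ZV[j js uj]]; first by exists i.
  by exists j; rewrite // inE js orbT.
- by rewrite big_setU1 //= subSS; have := gV _ is_i _ vV; lia.
- nia.
Qed.

End Counting.

(** * The extremal computation *)

(** With b = 2k - 1, the hypotheses give
   (h + 1) r <= 2kh + b (h - a) + 2 (2ha - a^2), where k + 1 - m >= h + 1 was
   used on the left. The bound on n that follows is increasing in h, so h may be
   replaced by k; then (2k + 1) a - 2 a^2 <= (2k + 1)^2 / 8. *)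
Lemma order_bound k h m n r a Sg Sf ex ex' :
  h + m <= k -> a <= h -> n <= r + 2 * h -> ex <= ex' ->
  k.+1 * r + ex' <= m * r + (2 * k * h + Sg) + 2 * Sf ->
  Sg <= ex + (2 * k).-1 * (h - a) -> Sf + a ^ 2 <= 2 * h * a ->
  8 * k.+1 * n <= 52 * k ^ 2 + 12 * k + 1.
Proof.
move=> hm ah nr exx cnt Sgle Sfle.
have rh : h.+1 * r + (2 * k).-1 * a + 2 * a ^ 2
    <= 2 * k * h + (2 * k).-1 * h + 4 * h * a.
  have : h.+1 * r + m * r <= k.+1 * r by rewrite -mulnDl leq_mul2r; lia.
  have : (2 * k).-1 * (h - a) + (2 * k).-1 * a = (2 * k).-1 * h.
    by rewrite -mulnDr subnK.
  lia.
move: rh nr; clear Sgle Sfle cnt exx.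
case: h ah hm => [|h] ah hm rh nr.
  have r0 : r = 0 by lia.
  have -> : n = 0 by lia.
  by rewrite muln0.
(* No truncated subtraction is left after k := h.+1 + j. *)
have [j kE] : exists j, k = h.+1 + j by exists (k - h.+1); lia.
have bE : (2 * k).-1 = (2 * (h + j)).+1 by lia.
rewrite bE in rh; subst k; clear bE hm.
set k := h.+1 + j.
(* The bound with h replaced by k; the difference of the two sides, multiplied
   by h.+2, is j times a polynomial with nonnegative coefficients. *)
have nX : k.+1 * n + k + 2 * a ^ 2 <= 2 * k * k.+1 + 4 * k ^ 2 + (2 * k).+1 * a.
  rewrite -(@leq_pmul2l h.+2) //.
  have le1 : k.+1 * (h.+2 * n) <= k.+1 * (h.+2 * r + 2 * h.+1 * h.+2).
    by have := leq_mul (leqnn (k.+1 * h.+2)) nr; lia.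
  have le2 := leq_mul (leqnn k.+1) rh.
  rewrite /k in le1 le2 *.
  lia.
have sq : 8 * (2 * k).+1 * a <= (2 * k).+1 ^ 2 + 16 * a ^ 2.
  have [] := nat_Cauchy (2 * k).+1 (4 * a); lia.
lia.
Qed.

(** * Colored edge sets *)

Section ColoredEdges.

Variables (T : finType) (C : eqType) (c : {set T} -> C).
Implicit Types (E M : {set {set T}}) (A B : {set T}) (s : seq {set T}).

Definition properly_colored E :=
  {in E &, forall A B, A != B -> ~~ [disjoint A & B] -> c A != c B}.

Definition edge_set E := {in E, forall A, #|A| = 2}.

Definition rainbow M :=
  {in M &, forall A B, A != B -> [disjoint A & B] /\ c A != c B}.

Definition deg E x := #|[set A in E | x \in A]|.

Definition color_class E A := [set B in E | c B == c A].

(** What is left of E after deleting the ends of the edges of s, but keeping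
   their colors. *)
Definition residual E s := [set A in E | all (fun B => [disjoint A & B]) s].

Lemma rainbowU1 A M :
    rainbow M -> {in M, forall B, [disjoint B & A] /\ c B != c A} ->
  rainbow (A |: M).
Proof.
move=> rM MA B1 B2; rewrite !inE.
case/predU1P=> [->|B1M] /predU1P[->|B2M]; rewrite ?eqxx // => neqB.
- by have [? ?] := MA _ B2M; rewrite disjoint_sym eq_sym.
- exact: MA.
- exact: rM.
Qed.

(** Edges of one color are disjoint, so each uses up a vertex of B. *)
Lemma card_color_meeting E a B :
  properly_colored E -> #|[set A in E | (c A == a) && ~~ [disjoint A & B]]| <= #|B|.
Proof.
move=> pE; apply: card_disjoint_hitting => [A1 A2|A]; last first.
  by rewrite !inE => /and3P[].
rewrite !inE => /and3P[A1E /eqP c1 _] /and3P[A2E /eqP c2 _] neqA.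
by apply: contraT => /(pE _ _ A1E A2E neqA); rewrite c1 c2 eqxx.
Qed.

Lemma card_color_at E a x :
  properly_colored E -> #|[set A in E | (x \in A) && (c A == a)]| <= 1.
Proof.
move=> pE; rewrite -(cards1 x); apply: leq_trans (card_color_meeting a _ pE).
apply/subset_leq_card/subsetP => A; rewrite !inE => /and3P[-> xA ->] /=.
by rewrite disjoint_sym disjoints1 xA.
Qed.

Lemma codegree_le1 E x y :
  edge_set E -> x != y -> #|[set A in E | (x \in A) && (y \in A)]| <= 1.
Proof.
move=> E2 neq_xy; rewrite -(cards1 [set x; y]).
apply/subset_leq_card/subsetP => A; rewrite !inE => /and3P[/E2 A2 xA yA].
by rewrite eq_sym eqEcard A2 cards2 neq_xy andbT subUset !sub1set xA.
Qed.

(** * The greedy algorithm *)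

(** The run of the algorithm, analyzed from its end; s lists chosen edges in
   order, L the colors of the later ones. Let e be the edge chosen first, and s'
   and L' come from the rest of the run.
   - If s' is nonempty, the rest has a color class of size at most
     2 * size s', which had at most two more edges before the ends of e were
     deleted; as the class of e is a smallest one, e can be put in front of s'.
   - If s' is empty and some color other than that of e and outside L' is
     present, all its edges meet e, so there are at most two of them, and s is e
     alone.
   - If s' is empty and there is no such color, the color of e joins L.
   The last clause, on a small class, is what the first case needs; it becomes
   available with the second case. *)
Lemma greedy_decomposition E (w : {set T} -> nat) :
    edge_set E -> properly_colored E ->
  exists s (L : seq C),
    [/\ {subset s <= E} /\
          exists M, [/\ M \subset E, rainbow M & #|M| = size s + size L],
        {in residual E s, forall A, c A \in L ++ map c s},
        forall s1 B s2, s = s1 ++ B :: s2 ->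
          #|color_class (residual E s) B| <= (size s2).*2.+1,
        {in s, forall B, {in color_class (residual E s) B, forall A, w B <= w A}}
      & s != [::] -> exists2 A, A \in E & #|color_class E A| <= (size s).*2].
Proof.
have [n] := ubnP #|E|; elim: n E => // n IHn E ltEn E2 pE.
have [->|[A0 A0E]] := set_0Vmem E.
  exists [::], [::]; split=> //; last by move=> [].
    by split=> //; exists set0; rewrite cards0; split=> // A; rewrite inE.
  by move=> A; rewrite !inE.
case: (arg_minnP (fun A => #|color_class E A|) A0E) => A1 A1E minA1.
have A1c : A1 \in color_class E A1 by rewrite inE eqxx andbT.
case: (arg_minnP w A1c) => e ec minw.
have: e \in color_class E A1 := ec; rewrite inE => /andP[eE /eqP ce] {ec}.
have cce : color_class E e = color_class E A1 by rewrite /color_class ce.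
rewrite -cce in minA1 minw => {A1 A1E A1c ce cce}.
pose E' := [set A in E | [disjoint A & e] && (c A != c e)].
have sE'E : E' \subset E by apply/subsetP => A; rewrite inE => /andP[].
have eE' : e \notin E' by rewrite inE eqxx !andbF.
have [|||s' [L' [[s'E' [M' [M'E' rM' M'size]]] resL' lens' minws' smalls']]] := IHn E'.
- rewrite ltnS in ltEn; apply: leq_trans ltEn; apply: proper_card.
  by rewrite properE sE'E; apply/subsetPn; exists e.
- by move=> A /(subsetP sE'E)/E2.
- by move=> A B /(subsetP sE'E) AE /(subsetP sE'E) BE; exact: pE.
have rM : rainbow (e |: M').
  apply: rainbowU1 => // B /(subsetP M'E'); rewrite inE.
  by case/and3P.
have ME : e |: M' \subset E.
  by rewrite subUset sub1set eE (subset_trans M'E').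
have Msize : #|e |: M'| = (size s' + size L').+1.
  by rewrite cardsU1 (contra (subsetP M'E' e)) // M'size.
(* Deleting the ends of e costs any other color at most two edges. *)
have meet_e B : B \in E -> c B != c e ->
    #|color_class E B| <= #|color_class E' B| + 2.
  move=> BE cB; rewrite -(E2 _ eE).
  apply: leq_trans (leq_add (leqnn _) (card_color_meeting (c B) e pE)).
  apply: leq_trans (leq_card_setU _ _); apply/subset_leq_card/subsetP => A.
  rewrite !inE => /andP[-> /eqP ->]; rewrite cB eqxx /= !andbT.
  by case: [disjoint A & e].
(* The class of e loses at least e itself in the residual graph. *)
have first_class s (k : nat) : e \in s -> #|color_class E e| <= k.+1.*2 ->
    #|color_class (residual E s) e| <= k.*2.+1.
  move=> es small; rewrite -ltnS -doubleS; apply: leq_trans small.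
  apply: proper_card; apply/properP; split.
    by apply/subsetP => A; rewrite !inE -andbA => /and3P[-> _ ->].
  exists e; rewrite !inE eE eqxx ?andbT //=.
  apply/negP => /allP/(_ e es); rewrite -setI_eq0 setIid -cards_eq0.
  by rewrite (E2 _ eE).
have firstw s : {in color_class (residual E s) e, forall A, w e <= w A}.
  move=> A; rewrite !inE -andbA => /and3P[AE _ cA].
  apply: minw; change (A \in color_class E e); by rewrite inE AE.
have [s'0|s'N0] := eqVneq s' [::].
  subst s'; rewrite add0n in Msize.
  have E'L A : A \in E -> [disjoint A & e] -> c A != c e -> c A \in L'.
    move=> AE dA cA; have := resL' A; rewrite cats0; apply.
    by rewrite !inE AE dA cA.
  have [/existsP[b /and3P[bE cb bL]]|noB] :=
      boolP [exists b, [&& b \in E, c b != c e & c b \notin L']].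
    have b2 : #|color_class E b| <= 2.
      have := meet_e _ bE cb; rewrite (_ : color_class E' b = set0) ?cards0 //.
      apply/setP => A; rewrite !inE; apply/negP => /andP[/and3P[AE dA cA] /eqP cAb].
      by case/negP: bL; rewrite -cAb E'L.
    exists [:: e], L'; split.
    - split; first by move=> A; rewrite inE => /eqP ->.
      by exists (e |: M').
    - move=> A; rewrite !inE mem_cat inE /= andbT => /andP[AE dA].
      by case: (eqVneq (c A)) => [|cA]; rewrite ?orbT // E'L.
    - case=> [|? []] //= B s2 [<- <-].
      by apply: first_class; rewrite ?mem_head // (leq_trans (minA1 _ bE)).
    - move=> B; rewrite inE => /eqP ->; exact: firstw.
    - by exists b.
  exists [::], (c e :: L'); split=> //; last by case.
    by split=> //; exists (e |: M'); split=> //; rewrite Msize.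
  move=> A; rewrite [map _ _]/= cats0 !inE /= andbT => AE.
  apply: contraR noB => NA; apply/existsP; exists A; rewrite AE.
  by move: NA; rewrite negb_or.
have [b bE' b_small] := smalls' s'N0.
have /and3P[bE _ cb] : [&& b \in E, [disjoint b & e] & c b != c e].
  by move: bE'; rewrite inE.
have b_smallE : #|color_class E b| <= (size s').+1.*2.
  by rewrite doubleS -addn2 (leq_trans (meet_e _ bE cb)) // leq_add2r.
have e_small := leq_trans (minA1 _ bE) b_smallE.
have res_sub B : B \in s' ->
    color_class (residual E (e :: s')) B \subset color_class (residual E' s') B.
  move=> /s'E'; rewrite inE => /and3P[_ _ cB].
  apply/subsetP => A; rewrite !inE /= => /andP[/and3P[-> -> ->]] /eqP ->.
  by rewrite cB eqxx.
exists (e :: s'), L'; split.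
- split; last by exists (e |: M'); rewrite Msize addSn.
  by move=> A; rewrite inE => /predU1P[->//|/s'E'/(subsetP sE'E)].
- move=> A; rewrite !inE /= => /and3P[AE dA aA].
  have [->|cA] := eqVneq (c A) (c e); first by rewrite mem_cat mem_head orbT.
  have := resL' A; rewrite !mem_cat inE => /(_ _)/orP[]; rewrite ?inE ?AE ?dA ?cA //.
    by move=> ->.
  by move=> ->; rewrite !orbT.
- case=> [|? s1] B s2 [] => [<- s2E|_ s2E].
    by rewrite -s2E; apply: first_class; rewrite ?mem_head.
  apply: leq_trans (lens' _ _ _ s2E); apply/subset_leq_card/res_sub.
  by rewrite s2E mem_cat mem_head orbT.
- move=> B; rewrite inE => /predU1P[->|Bs]; first exact: firstw.
  by move=> A /(subsetP (res_sub _ Bs)); exact: minws'.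
- by exists b.
Qed.

Lemma card_meeting_at E v B :
  #|[set A in E | (v \in A) && ~~ [disjoint A & B]]|
    <= \sum_(x in B) #|[set A in E | (v \in A) && (x \in A)]|.
Proof.
rewrite -big_enum /=.
have := card_has_le (enum B) (fun A => (A \in E) && (v \in A))
  (fun x A => x \in A).
under [X in _ <= X]eq_bigr => x _.
  rewrite (_ : [set A | _] = [set A in E | (v \in A) && (x \in A)]); last first.
    by apply/setP => A; rewrite !inE andbA.
  over.
apply: leq_trans; apply/subset_leq_card/subsetP => A.
rewrite !inE => /and3P[-> -> AB] /=; apply/hasP.
move: AB; rewrite -setI_eq0 => /set0Pn[x]; rewrite inE => /andP[xA xB].
by exists x; rewrite ?mem_enum.
Qed.

(** * Counting degrees outside the chosen edges *)

(** An edge at a vertex of R has a color in L, or meets an edge of s, or survives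
   with the color of an edge of s. Each color occurs at most once at a vertex;
   among the edges at a vertex x of B in s, the edge B itself does not reach R;
   an edge of the third kind has at most two ends in R. *)
Lemma sum_deg_uncovered E (R : {set T}) s (L : seq C) :
    edge_set E -> properly_colored E -> {subset s <= E} ->
    {in s, forall B, [disjoint B & R]} ->
    {in residual E s, forall A, c A \in L ++ map c s} ->
  \sum_(v in R) deg E v <=
    size L * #|R| + \sum_(B <- s) \sum_(x in B) (deg E x).-1
    + \sum_(B <- s) 2 * #|color_class (residual E s) B|.
Proof.
move=> E2 pE sE sR resL.
have degv v : deg E v <= size L
    + \sum_(B <- s) \sum_(x in B) #|[set A in E | (v \in A) && (x \in A)]|
    + \sum_(B <- s) #|[set A in color_class (residual E s) B | v \in A]|.
  pose inL := [set A | ((A \in E) && (v \in A)) && has (fun a => c A == a) L].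
  pose met := [set A | ((A \in E) && (v \in A)) &&
                       has (fun B => ~~ [disjoint A & B]) s].
  pose old := [set A | ((A \in residual E s) && (v \in A)) &&
                       has (fun B => c A == c B) s].
  have sub : [set A in E | v \in A] \subset inL :|: met :|: old.
    apply/subsetP => A; rewrite !inE => /andP[AE vA]; rewrite AE vA /=.
    have [|] := boolP (has (fun B => ~~ [disjoint A & B]) s); first by rewrite orbT.
    rewrite -all_predC (@eq_all _ _ (fun B => [disjoint A & B])); last first.
      by move=> B /=; rewrite negbK.
    move=> dA; have := resL A; rewrite inE AE dA => /(_ isT).
    rewrite mem_cat orbF => /orP[cL|/mapP[B Bs cB]].
      by apply/orP; left; apply/hasP; exists (c A).
    by apply/orP; right; apply/hasP; exists B; rewrite //= cB eqxx.
  apply: leq_trans (subset_leq_card sub) _.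
  apply: leq_trans (leq_card_setU _ _) _; apply: leq_add.
    apply: leq_trans (leq_card_setU _ _) _; apply: leq_add.
      apply: leq_trans (card_has_le _ _ _) _.
      rewrite -sum1_size; apply: leq_sum => a _.
      apply: leq_trans (card_color_at a v pE).
      by apply/subset_leq_card/subsetP => A; rewrite !inE andbA.
    apply: leq_trans (card_has_le _ _ _) _.
    apply: leq_sum => B _; apply: leq_trans (card_meeting_at E v B).
    by apply/subset_leq_card/subsetP => A; rewrite !inE andbA.
  apply: leq_trans (card_has_le _ _ _) _.
  apply: leq_sum => B _; apply/subset_leq_card/subsetP => A.
  by rewrite !inE => /andP[/andP[/andP[-> ->] ->] ->].
apply: leq_trans (leq_sum _ (fun v _ => degv v)) _.
rewrite 2!big_split /= sum_nat_const mulnC.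
apply: leq_add; first apply: leq_add => //; rewrite exchange_big /= !big_seq.
  apply: leq_sum => B Bs; rewrite exchange_big /=.
  apply: leq_sum => x xB.
  have xR : x \notin R by rewrite (disjointFr (sR _ Bs) xB).
  pose F := [set A in E | x \in A].
  have BF : B \in F by rewrite inE sE.
  have -> : \sum_(v in R) #|[set A in E | (v \in A) && (x \in A)]|
      = \sum_(A in F) #|A :&: R|.
    rewrite sum_card_setI; apply: eq_bigr => v _; congr #|pred_of_set _|.
    by apply/setP => A; rewrite !inE -andbA [(v \in A) && _]andbC.
  have -> : (deg E x).-1 = \sum_(A in F :\ B) 1.
    by rewrite sum1_card /deg -/F (cardsD1 B F) BF.
  rewrite (big_setD1 B BF) /= (_ : B :&: R = set0) ?cards0 ?add0n; last first.
    by apply/eqP; rewrite setI_eq0 sR.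
  apply: leq_sum => A; rewrite !inE => /and3P[_ AE xA].
  rewrite -ltnS -(E2 _ AE); apply: proper_card.
  rewrite properE subsetIl; apply/subsetPn; exists x => //.
  by rewrite inE (negbTE xR) andbF.
apply: leq_sum => B Bs; rewrite -sum_card_setI mulnC -sum_nat_const.
apply: leq_sum => A; rewrite !inE => /andP[/andP[AE _] _].
by rewrite -(E2 _ AE) subset_leq_card ?subsetIl.
Qed.

(** * Assembling the proof *)

(** The reduced case: the algorithm itself succeeds, or the degree count
   contradicts the lower bound on #|V|. *)
Lemma reduced_graph_rainbow k E (V : {set T}) :
    edge_set E -> properly_colored E -> {in E, forall A, A \subset V} ->
    {in V, forall x, k < deg E x <= 3 * k} ->
    {in E, forall A, exists2 x, x \in A & deg E x = k.+1} ->
    52 * k ^ 2 + 12 * k + 1 < 8 * k.+1 * #|V| ->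
  exists M, [/\ M \subset E, rainbow M & k < #|M|].
Proof.
move=> E2 pE sEV degV lowE ltV.
pose w A := \sum_(x in A) deg E x.
have [s [L [[sE [M [ME rM Msize]]] resL lens minw _]]] := greedy_decomposition w E2 pE.
have [Mk|kM] := leqP #|M| k; last by exists M.
suff : 8 * k.+1 * #|V| <= 52 * k ^ 2 + 12 * k + 1 by rewrite leqNgt ltV.
pose R := [set x in V | all (fun B : {set T} => x \notin B) s].
have dR B : B \in s -> [disjoint B & R].
  move=> Bs; rewrite disjoint_sym disjoint_subset; apply/subsetP => x.
  by rewrite !inE => /andP[_ /allP/(_ B Bs)].
have resR A : A \in residual E s -> A \subset R.
  rewrite inE => /andP[AE /allP dA]; apply/subsetP => x xA.
  rewrite inE (subsetP (sEV _ AE)) //=; apply/allP => B /dA dAB.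
  by rewrite (disjointFr dAB xA).
have cardV : #|V| <= #|R| + 2 * size s.
  have sub : V \subset R :|: [set x | (x \in V) && has (fun B : {set T} => x \in B) s].
    apply/subsetP => x xV; rewrite !inE xV /= -[X in _ || X]negbK -all_predC.
    by rewrite orbN.
  apply: leq_trans (subset_leq_card sub) _.
  apply: leq_trans (leq_card_setU _ _) _; rewrite leq_add2l.
  apply: leq_trans (card_has_le _ _ _) _.
  rewrite mulnC -sum1_size big_distrl /= !big_seq; apply: leq_sum => B Bs.
  rewrite mul1n -(E2 _ (sE _ Bs)); apply/subset_leq_card/subsetP => x.
  by rewrite inE => /andP[].
have wE A : A \in E -> k.+1.*2 <= w A <= k.+1 + 3 * k.
  move=> AE; have [x xA dx] := lowE _ AE.
  have degA y : y \in A -> k < deg E y <= 3 * k.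
    by move/(subsetP (sEV _ AE)); exact: degV.
  have [y yA Axy] := other_endpoint (E2 _ AE) xA.
  rewrite /w (big_setD1 x xA) Axy big_set1 /= dx.
  by have /andP[] := degA _ yA; lia.
(* The excess of B over the least possible degree sum is matched by vertices of
   R whose degree has at least the same excess: an edge in R of the color of B
   has degree sum at least w B, and one of its ends has degree exactly k.+1. *)
pose f B := #|color_class (residual E s) B|.
pose g B := w B - k.+1.*2.
pose high B := [set x in R | g B <= deg E x - k.+1].
have fhigh B : B \in s -> f B <= #|high B|.
  move=> Bs; apply: card_disjoint_hitting => [A1 A2|A].
    rewrite !inE => /andP[/andP[A1E _] /eqP c1] /andP[/andP[A2E _] /eqP c2] neqA.
    by apply: contraT => /(pE _ _ A1E A2E neqA); rewrite c1 c2 eqxx.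
  move=> Ac; have wBA := minw B Bs A Ac.
  move: Ac; rewrite inE => /andP[Ares _].
  have AE : A \in E by move: Ares; rewrite inE => /andP[].
  have [x xA dx] := lowE _ AE.
  have [y yA Axy] := other_endpoint (E2 _ AE) xA.
  rewrite -setI_eq0; apply/set0Pn; exists y.
  rewrite inE yA inE (subsetP (resR _ Ares)) //=.
  move: wBA; rewrite /g {2}/w (big_setD1 x xA) Axy big_set1 /= dx; lia.
have [||||Z [Zs ZV gZ fZ]] := @partial_representatives _ _ s f g high
  (fun x => deg E x - k.+1) (2 * k).-1.
- exact: lens.
- exact: fhigh.
- by move=> B _ x; rewrite inE => /andP[].
- by move=> B /sE/wE; rewrite /g; lia.
have ZR : Z \subset R.
  by apply/subsetP => x /ZV[B _]; rewrite inE => /andP[].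
have := sum_deg_uncovered E2 pE sE dR resL.
have -> : \sum_(v in R) deg E v = k.+1 * #|R| + \sum_(v in R) (deg E v - k.+1).
  rewrite mulnC -sum_nat_const -big_split; apply: eq_bigr => v.
  by rewrite inE => /andP[/degV/andP[ltk _] _]; rewrite /= subnKC.
have -> : \sum_(B <- s) \sum_(x in B) (deg E x).-1 = 2 * k * size s + \sum_(B <- s) g B.
  rewrite mulnC -sum1_size big_distrl -big_split !big_seq; apply: eq_bigr => B /sE BE.
  have : w B = \sum_(x in B) (deg E x).-1 + 2.
    rewrite -(E2 _ BE) -sum1_card -big_split; apply: eq_bigr => x xB.
    by rewrite /= addn1 prednK //; have := degV _ (subsetP (sEV _ BE) _ xB); lia.
  by have := wE _ BE; rewrite /g /=; lia.
rewrite -big_distrr /= => cnt.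
apply: (order_bound _ Zs cardV _ cnt gZ fZ); first by rewrite -Msize.
by rewrite [leqRHS](big_setID Z) /= (setIidPr ZR) leq_addr.
Qed.

(** Each edge of M blocks at most three edges at v: one for each of its ends, and
   one for its color. *)
Lemma extend_rainbow E M v :
    edge_set E -> properly_colored E -> M \subset E -> rainbow M ->
    {in M, forall B, v \notin B} -> 3 * #|M| < deg E v ->
  exists A, [/\ A \in E, A \notin M & rainbow (A |: M)].
Proof.
move=> E2 pE ME rM Mv ltM.
have [/existsP[A /and3P[AE vA /forall_inP okA]]|noA] :=
  boolP [exists A, [&& A \in E, v \in A
           & [forall (B | B \in M), [disjoint B & A] && (c B != c A)]]].
  exists A; split=> //.
    by apply/negP => /Mv; rewrite vA.
  by apply: rainbowU1 => // B /okA /andP[].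
suff : deg E v <= 3 * #|M| by rewrite leqNgt ltM.
pose met := [set A | ((A \in E) && (v \in A)) &&
                       has (fun B => ~~ [disjoint A & B]) (enum M)].
pose old := [set A | ((A \in E) && (v \in A)) &&
                       has (fun B => c A == c B) (enum M)].
have sub : [set A in E | v \in A] \subset met :|: old.
  apply/subsetP => A; rewrite !inE => /andP[AE vA]; rewrite AE vA /=.
  apply: contraR noA; rewrite negb_or -!all_predC => /andP[/allP dA /allP cA].
  apply/existsP; exists A; rewrite AE vA /=; apply/forall_inP => B BM.
  have BM' : B \in enum M by rewrite mem_enum.
  have := dA _ BM'; have := cA _ BM'; rewrite /= negbK disjoint_sym eq_sym.
  by move=> -> ->.
apply: leq_trans (subset_leq_card sub) _.
apply: leq_trans (leq_card_setU _ _) _; rewrite (mulnDl 2 1) mul1n; apply: leq_add.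
  apply: leq_trans (card_has_le _ _ _) _; rewrite big_enum /= mulnC -sum_nat_const.
  apply: leq_sum => B BM; rewrite -(E2 _ (subsetP ME _ BM)) -sum1_card.
  apply: leq_trans (_ : _ <= \sum_(x in B) #|[set A in E | (v \in A) && (x \in A)]|) _.
    apply: leq_trans (card_meeting_at E v B).
    by apply/subset_leq_card/subsetP => A; rewrite !inE andbA.
  apply: leq_sum => x xB; apply: codegree_le1 => //.
  by apply: contraTneq xB => <-; exact: Mv.
apply: leq_trans (card_has_le _ _ _) _; rewrite big_enum /= -sum1_card.
apply: leq_sum => B BM; apply: leq_trans (card_color_at (c B) v pE).
by apply/subset_leq_card/subsetP => A; rewrite !inE andbA.
Qed.

Lemma rainbow_subset d M :
  rainbow M -> d <= #|M| ->
  exists N : {set {set T}}, [/\ N \subset M, rainbow N & #|N| = d].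
Proof.
move=> rM dM; pose N := [set A in take d (enum M)].
have NM : N \subset M.
  by apply/subsetP => A; rewrite inE => /mem_take; rewrite mem_enum.
exists N; split=> //.
  by move=> A B /(subsetP NM) AM /(subsetP NM) BM; exact: rM.
by rewrite cardsE (card_uniqP _) ?take_uniq ?enum_uniq // size_takel -?cardE.
Qed.

(** The hypothesis on #|V| is the bound of the theorem multiplied by 8 d; it is
   inherited by d - 1 and #|V| - 1 when d > 1, and is required only for d > 0
   because the induction starts at the empty matching. *)
Lemma large_order_rainbow d E (V : {set T}) :
    edge_set E -> properly_colored E -> {in E, forall A, A \subset V} ->
    {in V, forall x, d <= deg E x} ->
    (0 < d -> 52 * d ^ 2 + 41 < 8 * d * #|V| + 92 * d) ->
  exists M, [/\ M \subset E, rainbow M & #|M| = d].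
Proof.
elim: d E V => [|k IHk] E V.
  by move=> *; exists set0; rewrite sub0set cards0; split=> // A; rewrite inE.
have [n] := ubnP #|E|; elim: n E => // n IHn E ltEn E2 pE sEV degV ltV.
have subE E' : E' \subset E -> [/\ edge_set E', properly_colored E'
                                 & {in E', forall A, A \subset V}].
  move=> /subsetP sE'E; split=> [A /sE'E/E2|A B /sE'E AE /sE'E BE|A /sE'E/sEV] //.
  exact: pE.
(* A vertex of large degree is removed, then matched at the end. *)
have [/exists_inP[v vV degv]|small] := boolP [exists v in V, 3 * k < deg E v].
  pose E' := [set A in E | v \notin A].
  have sE'E : E' \subset E by apply/subsetP => A; rewrite inE => /andP[].
  have [E'2 pE' sE'V] := subE _ sE'E.
  have [|||M [ME' rM Mk]] := IHk E' (V :\ v) E'2 pE'.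
  - by move=> A AE'; rewrite subsetD1 sE'V //; move: AE'; rewrite inE => /andP[].
  - move=> x; rewrite !inE => /andP[xv xV].
    rewrite -ltnS; apply: leq_trans (degV _ xV) _.
    rewrite -addn1; apply: leq_trans (leq_add (leqnn _) (codegree_le1 E2 xv)).
    apply: leq_trans (leq_card_setU _ _).
    apply/subset_leq_card/subsetP => A; rewrite !inE => /andP[-> ->] /=.
    by rewrite andbT orNb.
  - by move: (ltV isT); rewrite (cardsD1 v V) vV; nia.
  have ME := subset_trans ME' sE'E.
  have [B /(subsetP ME')||A [AE AM rAM]] := @extend_rainbow E M v E2 pE ME rM.
  - by rewrite inE => /andP[].
  - by rewrite Mk.
  exists (A |: M); split=> //; first by rewrite subUset sub1set AE.
  by rewrite cardsU1 AM Mk.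
(* Once no edge can be removed without creating a degree below k.+1, every edge
   has an end of degree k.+1, which caps the degree sums. *)
have [/exists_inP[A AE /forall_inP highA]|lowE] :=
    boolP [exists A in E, [forall x in A, k.+1 < deg E x]].
  have sE'E : E :\ A \subset E := subsetDl _ _.
  have [E'2 pE' sE'V] := subE _ sE'E.
  have [||M [ME rM Mk]] := IHn (E :\ A) _ E'2 pE' sE'V _ ltV.
  - by move: ltEn; rewrite (cardsD1 A E) AE.
  - move=> x xV; have [xA|xA] := boolP (x \in A).
      rewrite -ltnS; apply: leq_trans (highA _ xA) _.
      rewrite /deg (cardsD1 A) inE AE xA add1n ltnS.
      by apply/subset_leq_card/subsetP => B; rewrite !inE andbA.
    apply: leq_trans (degV _ xV) _; apply/subset_leq_card/subsetP => B.
    rewrite !inE => /andP[-> xB]; rewrite xB !andbT.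
    by apply: contraNneq xA => <-.
  by exists M; rewrite (subset_trans ME).
have [|||M [ME rM kM]] := @reduced_graph_rainbow k E V E2 pE sEV.
- move=> x xV; rewrite degV //= leqNgt; apply: contra small => ltx.
  by apply/exists_inP; exists x.
- move=> A AE; move: lowE; rewrite negb_exists => /forallP/(_ A).
  rewrite AE negb_forall /= => /existsP[x]; rewrite negb_imply -leqNgt => /andP[xA dx].
  exists x => //; apply/eqP; rewrite eqn_leq dx degV //.
  exact: (subsetP (sEV _ AE)).
- by move: (ltV isT); nia.
have [N [NM rN Nk]] := rainbow_subset rM kM.
by exists N; rewrite (subset_trans NM).
Qed.

End ColoredEdges.

Lemma min_degree_le (T : finType) (e : rel T) x : min_degree e <= degree e x.
Proof.
rewrite /min_degree; have := mem_index_enum x.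
elim: (index_enum T) => // y r IHr; rewrite inE big_cons geq_min.
by case/predU1P => [->|/IHr ->]; rewrite ?leqnn ?orbT.
Qed.

Local Open Scope ring_scope.

Theorem theorem1 (T : finType) (e : rel T)
  (e_sym : symmetric e) (e_irr : irreflexive e)
  (C : eqType) (c : {set T} -> C) (c_proper : proper_edge_coloring e c)
  (delta_ge1 : (1 <= min_degree e)%N)
  (order_large :
     13 / 2 * (min_degree e)%:R - 23 / 2 + 41 / (8 * (min_degree e)%:R)
       < #|T|%:R :> rat) :
  exists M : {set {set T}}, rainbow_matching e c M /\ #|M| = min_degree e.
Proof.
have E2 : edge_set (edges e).
  move=> _ /imsetP[[x y] /= exy ->]; rewrite cards2.
  by case: eqVneq exy => // ->; rewrite inE /= e_irr.
have [|x _||M [ME rM Md]] :=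
  @large_order_rainbow T C c (min_degree e) (edges e) setT E2 c_proper.
- by move=> A _; rewrite subsetT.
- apply: leq_trans (min_degree_le e x) _.
  have inj : injective (fun y => [set x; y]).
    move=> y z /setP yz; have := yz y; have := yz z.
    by rewrite !inE !eqxx !orbT; case: eqVneq => [-> /esym|_ /=]; case: eqVneq.
  rewrite /degree -(card_imset _ inj); apply/subset_leq_card/subsetP => A.
  case/imsetP=> y; rewrite inE => exy ->; rewrite inE set21 andbT.
  by apply/imsetP; exists (x, y); rewrite ?inE.
- move=> d_gt0; rewrite cardsT; move: order_large d_gt0.
  move: (min_degree e) #|T| => d n order_large d_gt0.
  have d_pos : 0 < d%:R :> rat by rewrite ltr0n.
  rewrite -(ltr_nat rat) !(natrD, natrM, natrX).
  have : 13 / 2 * d%:R - 23 / 2 + 41 / (8 * d%:R)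
      = (52 * d%:R ^+ 2 - 92 * d%:R + 41) / (8 * d%:R) :> rat.
    by field; lra.
  move=> E0; move: order_large; rewrite E0 ltr_pdivrMr; last by lra.
  lra.
exists M; split=> //; split; [split=> //|].
  by apply/trivIsetP => A B AM BM /(rM _ _ AM BM)[].
by move=> A B AM BM cAB; apply/eqP/contraT => /(rM _ _ AM BM)[_]; rewrite cAB eqxx.
Qed.
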